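(* Assume that $\inf_{x\in\mathbb{R}^n}h(x)<0<\sup_{x\in\mathbb{R}^n}h(x)$, and that there exists $\zeta\in\{x\in\mathbb{R}^n: h(x)=0\}$ such that for all $x\in\mathbb{R}^n$, $x^TBx=0$ implies $(B\zeta+d)^Tx=0$. Assume also that $f_2(x)>0$ whenever $h(x)=0$. Then the optimal value $$\lambda^*=\inf_{x\in\mathbb{R}^n}\left\{\frac{f_1(x)}{f_2(x)}: h(x)=0\right\}$$ satisfies $$\lambda^*=\sup_{\lambda,\mu\in\mathbb{R}}\left\{\lambda:\begin{pmatrix}A_1-\lambda A_2+\mu B & b_1-\lambda b_2+\mu d\\ b_1^T-\lambda b_2^T+\mu d^T & c_1-\lambda c_2\end{pmatrix}\succeq 0\right\}.$$
   Context: For $i=1,2$ let $f_i(x)=x^TA_ix+2b_i^Tx+c_i$ and let $h(x)=x^TBx+2d^Tx$ be functions on $\mathbb{R}^n$, where $A_1,A_2,B$ are real symmetric $n\times n$ matrices (possibly indefinite), $b_1,b_2,d\in\mathbb{R}^n$ and $c_1,c_2\in\mathbb{R}$. The notation $M\succeq 0$ means that the symmetric matrix $M$ is positive semidefinite. Optimal values are taken in the extended reals, with $\sup\emptyset=-\infty$. *)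

(* Defs.v *)
From HB Require Import structures.
From mathcomp Require Import all_boot all_order all_algebra.
From mathcomp Require Import sesquilinear.
From mathcomp Require Import all_classical all_reals ereal.

Set Implicit Arguments.
Unset Strict Implicit.
Unset Printing Implicit Defensive.

Import Order.TTheory GRing.Theory Num.Theory.

Local Open Scope ring_scope.

Definition dotv (R : realType) (n : nat) (u v : 'cV[R]_n) : R :=
  (u^T *m v) ord0 ord0.

Definition qform (R : realType) (n : nat) (A : 'M[R]_n) (x : 'cV[R]_n) : R :=
  (x^T *m A *m x) ord0 ord0.

Definition quad (R : realType) (n : nat) (A : 'M[R]_n) (b : 'cV[R]_n) (c : R)
    (x : 'cV[R]_n) : R :=
  qform A x + 2 * dotv b x + c.

Definition psdmx (R : realType) (n : nat) (M : 'M[R]_n) : Prop :=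
  M \is symmetricmx /\ forall x : 'cV[R]_n, 0 <= qform M x.

(* Main.v *)
(** Homogenize: for [z = (x, t)] put [F z = t^2 f (x / t)] and [H z = t^2 h (x / t)], so that
    the matrix of the semidefinite program is that of [F + mu H] with [f = f1 - lambda f2].
    The hypothesis on [zeta] is what makes [F] nonnegative on the whole zero set of [H]:
    at a point [(x, 0)] of it the line [zeta + R x] lies in [h = 0], hence [f >= 0] on that
    line and its leading coefficient [F (x, 0)] is nonnegative.  As [H] is indefinite, Finsler's
    lemma provides [mu] with [F + mu H >= 0].  So [lambda] is feasible for the semidefinite
    program exactly when [lambda <= f1 / f2] on [h = 0]. *)

Require Import Defs.
From mathcomp Require Import all_boot all_order all_algebra.
From mathcomp Require Import sesquilinear ring lra.
From mathcomp Require Import all_classical all_reals ereal.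

Set Implicit Arguments.
Unset Strict Implicit.
Unset Printing Implicit Defensive.

Import Order.TTheory GRing.Theory Num.Theory.

Local Open Scope classical_set_scope.
Local Open Scope ring_scope.

Lemma symmetricmxP (R : fieldType) (n : nat) (M : 'M[R]_n) :
  reflect (M^T = M) (M \is symmetricmx).
Proof.
by rewrite is_hermitianmxE expr0 scale1r map_mx_id // eq_sym; apply: eqP.
Qed.

(** The linear term cancels between two opposite arguments. If [c < 0], then [q = - (a / c) >= 0],
    and the values at [1 + q] and [- (1 + q)] add up to something negative. *)
Lemma lead_coef_ge0 (R : realFieldType) (a b c : R) :
  (forall s, 0 <= a + b * s + c * s ^+ 2) -> 0 <= c.
Proof.
move=> p_ge0; rewrite leNgt; apply/negP => c_lt0.
have := p_ge0 0; rewrite mulr0 expr0n mulr0 !addr0 => a_ge0.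
have q_ge0 : 0 <= - (a / c) by rewrite oppr_ge0 mulr_ge0_le0 // invr_le0 ltW.
set q := - (a / c) in q_ge0; have aq_ge0 : 0 <= a * q by rewrite mulr_ge0.
have := addr_ge0 (p_ge0 (1 + q)) (p_ge0 (- (1 + q))).
suff -> : a + b * (1 + q) + c * (1 + q) ^+ 2 + (a + b * - (1 + q) + c * (- (1 + q)) ^+ 2) =
    2 * (c - a - a * q) by lra.
by rewrite /q; field; rewrite lt_eqF.
Qed.

(** These are the roots of [c X^2 + 2 k X + a]; their product [a / c] is negative. The polynomial
    will be a quadratic form restricted to a line. *)
Lemma opposite_roots (R : rcfType) (a k c : R) : c < 0 -> 0 < a ->
  exists s t, [/\ s < 0, 0 < t, s * t * c = a,
    a + 2 * s * k + s ^+ 2 * c = 0 & a + 2 * t * k + t ^+ 2 * c = 0].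
Proof.
move=> c_lt0 a_gt0; have c_neq0 : c != 0 by rewrite lt_eqF.
pose r := Num.sqrt (k ^+ 2 - a * c).
have ac_lt0 : a * c < 0 by rewrite pmulr_rlt0.
have r2 : r ^+ 2 = k ^+ 2 - a * c.
  by rewrite sqr_sqrtr //; have := sqr_ge0 k; lra.
have : `|k| < r by rewrite -sqrtr_sqr ltr_sqrt; have := sqr_ge0 k; lra.
rewrite ltr_norml => /andP[k_gt k_lt].
(* As [c < 0], the root with [+ r] is the negative one. *)
exists ((r - k) / c), ((- r - k) / c); split.
- by rewrite ltr_ndivrMr // mul0r; lra.
- by rewrite ltr_ndivlMr // mul0r; lra.
- transitivity ((k ^+ 2 - r ^+ 2) / c); first by field.
  by rewrite r2; field.
- transitivity (a + (r ^+ 2 - k ^+ 2) / c); first by field.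
  by rewrite r2; field.
- transitivity (a + (r ^+ 2 - k ^+ 2) / c); first by field.
  by rewrite r2; field.
Qed.

Section QuadraticForms.
Variables (R : realType) (n : nat).
Implicit Types (M N A : 'M[R]_n) (x y u : 'cV[R]_n).

Lemma dotvC x y : dotv x y = dotv y x.
Proof. by rewrite /dotv -[x in RHS]trmxK -trmx_mul [RHS]mxE. Qed.

Lemma dotvDr u x y : dotv u (x + y) = dotv u x + dotv u y.
Proof. by rewrite /dotv mulmxDr mxE. Qed.

Lemma dotvDl u x y : dotv (x + y) u = dotv x u + dotv y u.
Proof. by rewrite !(dotvC _ u) dotvDr. Qed.

Lemma dotvZr u (s : R) x : dotv u (s *: x) = s * dotv u x.
Proof. by rewrite /dotv -scalemxAr mxE. Qed.

Lemma dotvZl u (s : R) x : dotv (s *: x) u = s * dotv x u.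
Proof. by rewrite !(dotvC _ u) dotvZr. Qed.

Lemma qformE M x : qform M x = dotv x (M *m x).
Proof. by rewrite /qform /dotv mulmxA. Qed.

Lemma qformDl M N x : qform (M + N) x = qform M x + qform N x.
Proof. by rewrite !qformE mulmxDl dotvDr. Qed.

Lemma qformZl (s : R) M x : qform (s *: M) x = s * qform M x.
Proof. by rewrite !qformE -scalemxAl dotvZr. Qed.

Lemma qformZr M (s : R) x : qform M (s *: x) = s ^+ 2 * qform M x.
Proof. by rewrite !qformE -scalemxAr dotvZr dotvZl mulrA -expr2. Qed.

Lemma dotv_mulmx_sym M x y : M \is symmetricmx ->
  dotv x (M *m y) = dotv (M *m x) y.
Proof. by move=> /symmetricmxP Msym; rewrite /dotv trmx_mul Msym mulmxA. Qed.

Lemma qform_line M x y (s : R) : M \is symmetricmx ->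
  qform M (x + s *: y) = qform M x + 2 * s * dotv (M *m x) y + s ^+ 2 * qform M y.
Proof.
move=> Msym; rewrite !qformE mulmxDr -scalemxAr !(dotvDl, dotvDr) !(dotvZl, dotvZr).
rewrite (dotvC y (M *m x)) (dotv_mulmx_sym x y Msym); ring.
Qed.

Lemma quad_line A (b : 'cV[R]_n) (c : R) x y (s : R) : A \is symmetricmx ->
  quad A b c (x + s *: y) =
  quad A b c x + 2 * dotv (A *m x + b) y * s + qform A y * s ^+ 2.
Proof.
by move=> Asym; rewrite /quad qform_line // dotvDr dotvDl dotvZr; ring.
Qed.

(* In the plane spanned by [z] and [w] the form [N] vanishes along [z + s w] and [z + t w]
   with [s < 0 < t]; the combination of [M (z + s w) >= 0] and [M (z + t w) >= 0]
   with weights [t] and [- s] has no cross term. *)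
Lemma finsler_ratio M N z w : M \is symmetricmx -> N \is symmetricmx ->
  (forall x, qform N x = 0 -> 0 <= qform M x) ->
  qform N w < 0 -> 0 < qform N z ->
  - qform M z / qform N z <= - qform M w / qform N w.
Proof.
move=> Msym Nsym M_ge0 Nw_lt0 Nz_gt0.
have [s [t [s_lt0 t_gt0 st Ns Nt]]] := opposite_roots (dotv (N *m z) w) Nw_lt0 Nz_gt0.
have := M_ge0 (z + s *: w); rewrite !qform_line // => /(_ Ns) Ms.
have := M_ge0 (z + t *: w); rewrite !qform_line // => /(_ Nt) Mt.
set m := dotv (M *m z) w in Ms Mt; set Mz := qform M z in Ms Mt *.
set Mw := qform M w in Ms Mt *; set Nw := qform N w in Nw_lt0 st *.
have : 0 <= (t - s) * (Mz - s * t * Mw).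
  have -> : (t - s) * (Mz - s * t * Mw) =
    t * (Mz + 2 * s * m + s ^+ 2 * Mw) + (- s) * (Mz + 2 * t * m + t ^+ 2 * Mw) by ring.
  by rewrite addr_ge0 // mulr_ge0 //; lra.
rewrite pmulr_rge0 ?subr_ge0 => [le_Mz|]; last by lra.
have Nw_neq0 : Nw != 0 by rewrite lt_eqF.
(* With [qform N z = s * t * Nw], the goal reduces to [s * t * Mw <= Mz]. *)
rewrite ler_pdivrMr // -st.
have -> : - Mw / Nw * (s * t * Nw) = - (s * t * Mw) by field.
by rewrite lerN2.
Qed.

(** Points with [N > 0] bound [mu] below by [- M / N], points with [N < 0] bound it above. By
    [finsler_ratio] no lower bound exceeds an upper one, so the supremum of the lower bounds serves
    as [mu]. *)
Lemma finsler M N : M \is symmetricmx -> N \is symmetricmx ->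
  (exists z, 0 < qform N z) -> (exists w, qform N w < 0) ->
  (forall x, qform N x = 0 -> 0 <= qform M x) ->
  exists mu : R, forall x, 0 <= qform (M + mu *: N) x.
Proof.
move=> Msym Nsym [z0 Nz0] [w0 Nw0] M_ge0.
pose E := [set - qform M z / qform N z | z in [set z | 0 < qform N z]].
have E_ub w : qform N w < 0 -> ubound E (- qform M w / qform N w).
  by move=> Nw _ [z /= Nz <-]; apply: finsler_ratio.
have E_neq0 : E !=set0 by exists (- qform M z0 / qform N z0), z0.
exists (sup E) => x; rewrite qformDl qformZl.
have [Nx|Nx|Nx] := ltgtP (qform N x) 0.
- have := ge_sup E_neq0 (E_ub x Nx).
  by rewrite ler_ndivlMr //; lra.
- have : - qform M x / qform N x <= sup E.
    apply: sup_upper_bound; last by exists x.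
    by split=> //; exists (- qform M w0 / qform N w0); apply: E_ub.
  by rewrite ler_pdivrMr //; lra.
- by rewrite Nx mulr0 addr0 M_ge0.
Qed.

End QuadraticForms.

Section Homogenization.
Variables (R : realType) (n : nat).
Implicit Types (A B : 'M[R]_n) (b d x zeta : 'cV[R]_n) (c e t mu : R).

Definition homog A b c : 'M[R]_(n + 1) := block_mx A b b^T c%:M.

Lemma homog_sym A b c : A \is symmetricmx -> homog A b c \is symmetricmx.
Proof.
move=> /symmetricmxP Asym; apply/symmetricmxP.
by rewrite /homog tr_block_mx Asym trmxK tr_scalar_mx.
Qed.

Lemma homogDZ A b c mu B d e :
  homog A b c + mu *: homog B d e = homog (A + mu *: B) (b + mu *: d) (c + mu * e).
Proof.
by rewrite /homog scale_block_mx add_block_mx linearD linearZ scale_scalar_mx -raddfD.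
Qed.

Lemma dotv_col_mx (m1 m2 : nat) (x1 y1 : 'cV[R]_m1) (x2 y2 : 'cV[R]_m2) :
  dotv (col_mx x1 x2) (col_mx y1 y2) = dotv x1 y1 + dotv x2 y2.
Proof. by rewrite /dotv tr_col_mx mul_row_col mxE. Qed.

Lemma qform_homog A b c x t :
  qform (homog A b c) (col_mx x t%:M) = qform A x + 2 * t * dotv b x + c * t ^+ 2.
Proof.
rewrite qformE mul_block_col dotv_col_mx dotvDr -qformE.
rewrite mul_mx_scalar dotvZr (dotvC x) [b^T *m x]mx11_scalar -/(dotv b x).
rewrite -scalar_mxM -raddfD /= {2}/dotv tr_scalar_mx -scalar_mxM mxE eqxx mulr1n.
by ring.
Qed.

Lemma qform_homog1 A b c x : qform (homog A b c) (col_mx x 1%:M) = quad A b c x.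
Proof. by rewrite qform_homog /quad; ring. Qed.

Lemma qform_homog_scale A b c x t : t != 0 ->
  qform (homog A b c) (col_mx x t%:M) = t ^+ 2 * quad A b c (t^-1 *: x).
Proof.
move=> t_neq0; rewrite -qform_homog1 -qformZr scale_col_mx scalerA divff // scale1r.
by rewrite scale_scalar_mx mulr1.
Qed.

(** The S-lemma with equality: Finsler's lemma for the homogenized pair, its hypothesis being
    checked separately at infinity ([t = 0]) and at finite points. *)
Lemma s_lemma_eq A b c B d e zeta : A \is symmetricmx -> B \is symmetricmx ->
  (exists x, 0 < quad B d e x) -> (exists x, quad B d e x < 0) ->
  quad B d e zeta = 0 ->
  (forall x, qform B x = 0 -> dotv (B *m zeta + d) x = 0) ->
  (forall x, quad B d e x = 0 -> 0 <= quad A b c x) ->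
  exists mu, psdmx (homog A b c + mu *: homog B d e).
Proof.
move=> Asym Bsym [x0 h_gt0] [y0 h_lt0] h_zeta B_zeta f_ge0.
have [|||mu mu_ge0] := finsler (homog_sym b c Asym) (homog_sym d e Bsym).
- by exists (col_mx x0 1%:M); rewrite qform_homog1.
- by exists (col_mx y0 1%:M); rewrite qform_homog1.
- move=> z; rewrite -[z]vsubmxK [dsubmx z]mx11_scalar.
  set x := usubmx z; set t := dsubmx z _ _.
  have [->|t_neq0] := eqVneq t 0.
    rewrite !qform_homog expr0n /= !mulr0 !mul0r !addr0 => Bx.
    (* [qform A x] is the leading coefficient of [quad A b c] along [zeta + s *: x]. *)
    apply: (@lead_coef_ge0 _ (quad A b c zeta) (2 * dotv (A *m zeta + b) x)) => s.
    by rewrite -quad_line // f_ge0 // quad_line // h_zeta B_zeta // Bx; ring.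
  (* For [t != 0] both forms are [t ^+ 2] times the quadratic functions at [t^-1 *: x]. *)
  rewrite !qform_homog_scale // => /eqP.
  rewrite mulf_eq0 sqrf_eq0 (negPf t_neq0) /= => /eqP /f_ge0.
  by apply: mulr_ge0; apply: sqr_ge0.
- exists mu; split=> //; rewrite homogDZ; apply: homog_sym.
  apply/symmetricmxP; rewrite linearD linearZ /=.
  by move/symmetricmxP: Asym => ->; move/symmetricmxP: Bsym => ->.
Qed.

End Homogenization.

Theorem theorem2p5 (R : realType) (n : nat)
    (A1 A2 B : 'M[R]_n) (b1 b2 d : 'cV[R]_n) (c1 c2 : R)
    (A1_sym : A1 \is symmetricmx) (A2_sym : A2 \is symmetricmx)
    (B_sym : B \is symmetricmx) :
  let f1 := quad A1 b1 c1 in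
  let f2 := quad A2 b2 c2 in
  let h := quad B d 0 in
  (ereal_inf [set (h x)%:E | x in [set: 'cV[R]_n]] < 0)%E ->
  (0 < ereal_sup [set (h x)%:E | x in [set: 'cV[R]_n]])%E ->
  (exists zeta : 'cV[R]_n, h zeta = 0 /\
    forall x : 'cV[R]_n, qform B x = 0 -> dotv (B *m zeta + d) x = 0) ->
  (forall x : 'cV[R]_n, h x = 0 -> 0 < f2 x) ->
  ereal_inf [set (f1 x / f2 x)%:E | x in [set x : 'cV[R]_n | h x = 0]] =
  ereal_sup [set l%:E | l in [set l : R | exists mu : R,
    psdmx (block_mx
      (A1 - l *: A2 + mu *: B)
      (b1 - l *: b2 + mu *: d)
      (b1^T - l *: b2^T + mu *: d^T)
      (c1 - l * c2)%:M)]].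
Proof.
move=> f1 f2 h /ereal_inf_lt[_ [y _ <-] h_lt0] /ereal_sup_gt[_ [x _ <-] h_gt0].
rewrite !lte_fin in h_lt0 h_gt0; move=> [zeta [h_zeta B_zeta]] f2_gt0.
have quadB l z : quad (A1 - l *: A2) (b1 - l *: b2) (c1 - l * c2) z = f1 z - l * f2 z.
  by rewrite /f1 /f2 /quad -!scaleNr qformDl qformZl dotvDl dotvZl; ring.
have block_homog l mu : block_mx (A1 - l *: A2 + mu *: B) (b1 - l *: b2 + mu *: d)
    (b1^T - l *: b2^T + mu *: d^T) (c1 - l * c2)%:M =
    homog (A1 - l *: A2) (b1 - l *: b2) (c1 - l * c2) + mu *: homog B d 0.
  by rewrite homogDZ /homog !(linearD, linearN, linearZ) /= mulr0 addr0.
apply/eqP; rewrite eq_le; apply/andP; split; last first.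
  (* Weak duality: at [(z, 1)] with [h z = 0] the [mu] term vanishes, leaving
     [0 <= f1 z - l * f2 z]. *)
  apply: ge_ereal_sup => _ [l [mu [_ psd]] <-].
  apply: le_ereal_inf_tmp => _ [z hz <-].
  have := psd (col_mx z 1%:M).
  rewrite block_homog qformDl qformZl !qform_homog1 quadB -/h hz mulr0 addr0.
  by rewrite lee_fin ler_pdivlMr ?f2_gt0 // subr_ge0.
have inf_le z : h z = 0 ->
    (ereal_inf [set (f1 x / f2 x)%:E | x in [set x : 'cV[R]_n | h x = 0%R]]
      <= (f1 z / f2 z)%:E)%E.
  by move=> hz; apply: ereal_inf_lbound; exists z.
move: inf_le; case: (ereal_inf _) => [l| |] inf_le.
(* A finite infimum [l] is itself feasible: [f1 - l * f2] is nonnegative on [h = 0], so the S-lemma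
   supplies [mu]. *)
- apply: ereal_sup_ubound; exists l => //=.
  have [|||z hz|mu psd] := @s_lemma_eq _ _ (A1 - l *: A2) (b1 - l *: b2) (c1 - l * c2)
    B d 0 zeta _ B_sym _ _ h_zeta B_zeta.
  + apply/symmetricmxP; rewrite linearB linearZ /=.
    by move/symmetricmxP: A1_sym => ->; move/symmetricmxP: A2_sym => ->.
  + by exists x.
  + by exists y.
  + by have := inf_le z hz; rewrite quadB lee_fin ler_pdivlMr ?f2_gt0 // subr_ge0.
  + by exists mu; rewrite block_homog.
(* The infimum is not [+oo], since [zeta] satisfies the constraint. *)
- by have := inf_le zeta h_zeta; rewrite leye_eq.
- exact: leNye.
Qed.
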